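(* Let $K$ be a compact and connected subgroup of $U(N)$ with Lie algebra $\mathfrak{k}$, and let $\mathfrak{t}$ be a torus algebra of $\mathfrak{k}$. Let $A \in \mathbb{C}^{N\times N}$, $A \neq 0$. Then the orbit $\mathcal{O}_K(A)$ is weakly rotationally symmetric if and only if (a) there exists $\Omega \in \mathfrak{k}$ such that $A$ is an eigenvector of the operator $\mathrm{ad}_\Omega$ to a non-zero eigenvalue; or equivalently, if and only if (b) there exist $U \in K$ and $\Delta \in \mathfrak{t}$ such that $UAU^\dagger$ is an eigenvector of the operator $\mathrm{ad}_\Delta$ to a non-zero eigenvalue.
   Context: $U(N)$ denotes the group of unitary $N\times N$ complex matrices and $\mathfrak{u}(N)$ its Lie algebra of skew-Hermitian matrices. For a compact connected subgroup $K\subset U(N)$ and $A\in\mathbb{C}^{N\times N}$, the $K$-orbit is $\mathcal{O}_K(A)=\{UAU^\dagger \mid U\in K\}$. The orbit is called weakly rotationally symmetric if $e^{i\varphi}\mathcal{O}_K(A)=\mathcal{O}_K(A)$ for all $\varphi\in\mathbb{R}$. For $\Omega\in\mathfrak{k}$, $\mathrm{ad}_\Omega:\mathbb{C}^{N\times N}\to\mathbb{C}^{N\times N}$, $X\mapsto \Omega X - X\Omega$. A torus algebra of $\mathfrak{k}$ is a maximal Abelian subalgebra of $\mathfrak{k}$. *)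

(* Defs.v *)
(* mathcomp + mathcomp-analysis + real-closed (complex R = R[i]). *)
From HB Require Import structures.
From mathcomp Require Import all_boot all_order all_algebra.
From mathcomp Require Import all_classical all_reals all_analysis.
From mathcomp Require Import complex.

Set Implicit Arguments.
Unset Strict Implicit.
Unset Printing Implicit Defensive.

Import Order.TTheory GRing.Theory Num.Theory.
Import numFieldNormedType.Exports.

Local Open Scope classical_set_scope.
Local Open Scope ring_scope.
Local Open Scope complex_scope.

(* The complex numbers over R, exposed as a numClosedFieldType so that the
   norm topology of mathcomp-analysis (numFieldNormedType) applies to it and
   to the matrix space 'M[Cplx R]_(m, n). *)
Definition Cplx (R : realType) : numClosedFieldType := R[i].

Section Defs.
Variables (R : realType) (n : nat).
(* Complex numbers C = R[i]; matrices C^{N x N} with N = n.+1 (N >= 1). *)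
Local Notation C := (Cplx R).
Local Notation M := 'M[C]_n.+1.

(* Conjugate transpose A^dagger. *)
Definition dagger (A : M) : M := (map_mx (fun z : C => z^*) A)^T.

(* U(N) *)
Definition unitary : set M := [set U | U * dagger U = 1].

(* u(N): skew-Hermitian matrices *)
Definition skew_hermitian : set M := [set X | dagger X = - X].

(* K is a subgroup of U(N). *)
Definition subgroup_of_U (K : set M) : Prop :=
  [/\ K `<=` unitary, K 1, (forall U V, K U -> K V -> K (U * V))
    & (forall U, K U -> K (dagger U))].

(* Matrix exponential, as the limit of the partial sums of the series. *)
Definition expm (X : M) : M :=
  lim ((fun m : nat => \sum_(k < m) ((k`!)%:R^-1 : C) *: X ^+ k) @ \oo).

(* The Lie algebra of a closed subgroup K of U(N):
   { X | exp(t X) \in K for all real t }. *)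
Definition lie_algebra (K : set M) : set M :=
  [set X | forall t : R, K (expm ((t%:C : C) *: X))].

(* Commutator and ad. *)
Definition ad (Om : M) (X : M) : M := Om * X - X * Om.

(* Real Lie subalgebra of g: real subspace of g closed under the bracket. *)
Definition real_subalgebra (g a : set M) : Prop :=
  [/\ a `<=` g, a 0,
      (forall X Y, a X -> a Y -> a (X + Y)),
      (forall (r : R) X, a X -> a ((r%:C : C) *: X))
    & (forall X Y, a X -> a Y -> a (ad X Y))].

Definition abelian_set (a : set M) : Prop :=
  forall X Y, a X -> a Y -> ad X Y = 0.

(* Torus algebra: maximal Abelian subalgebra of g. *)
Definition torus_algebra (g t : set M) : Prop :=
  [/\ real_subalgebra g t, abelian_set t
    & (forall s, real_subalgebra g s -> abelian_set s -> t `<=` s -> s = t)].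

(* K-orbit of A. *)
Definition orbit (K : set M) (A : M) : set M :=
  [set B | exists2 U, K U & B = U * A * dagger U].

(* e^{i phi} *)
Definition expi (phi : R) : C := (cos phi)%:C + 'i * (sin phi)%:C.

Definition weakly_rot_sym (K : set M) (A : M) : Prop :=
  forall phi : R, (fun B => expi phi *: B) @` orbit K A = orbit K A.

(* A is an eigenvector of ad_Om to a nonzero eigenvalue. *)
Definition ad_eigvec_nonzero (Om A : M) : Prop :=
  A != 0 /\ exists2 lam : C, lam != 0 & ad Om A = lam *: A.

End Defs.

(* Main.v *)
Require Import Defs.
From HB Require Import structures.
From mathcomp Require Import all_boot all_order all_algebra.
From mathcomp Require Import all_classical all_reals all_analysis.
From mathcomp Require Import complex.
From mathcomp Require Import ring lra.
Import Order.TTheory GRing.Theory Num.Theory.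
Import numFieldNormedType.Exports.
Set Implicit Arguments.
Unset Strict Implicit.
Unset Printing Implicit Defensive.
Local Open Scope classical_set_scope.
Local Open Scope ring_scope.

(** Write [k] for the Lie algebra of [K]. Everything rests on Cartan's lemma
    [tangent_lie]: if [U] runs through [K], [s -> 0] and [(U - 1) / s -> X],
    then [X] belongs to [k]. It makes [k] a closed real subspace, stable under
    brackets and under conjugation by [K].

    If the orbit is weakly rotationally symmetric, choose for each small angle
    an element [u] of [K] rotating [A] by that angle and, within its coset
    modulo the stabilizer of [A], as close to [1] as possible. Along an
    ultrafilter [u -> 1] and [(u - 1) / |u - 1| -> X], which lies in [k] and
    satisfies [ad X A = mu A]. If [mu = 0], then [exp (- s X)] stabilizes [A]
    and multiplying by it brings [u] closer to [1] than allowed; hence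
    [mu <> 0]. The converse is seen in an eigenbasis of the skew-Hermitian
    matrix.

    To conjugate [W] in [k] into the torus algebra, minimize
    [Re tr (V X)], [V = U W U^dagger], over [U] in [K]: at a minimum
    [Z = ad V X] satisfies [Re tr (Z Z) >= 0], so [Z = 0]. Repeating this in
    successive centralizers makes [W] commute with the whole torus algebra, and
    maximality puts it there. *)

Local Notation "x %:C" := (real_complex _ x) (format "x %:C").

Lemma conjc_conjC (R : realType) (z : Cplx R) : conjc z = z^*.
Proof. reflexivity. Qed.

Lemma imaginaryE (R : realType) : 'i = Complex 0 1 :> Cplx R.
Proof. reflexivity. Qed.

(** Telescoping step for a difference of powers: one factor is exchanged at a time, with [p] kept in
    front. *)
Lemma mulrBM_split (S : pzRingType) (p x y a b : S) :
  p * (x * a - y * b) = p * x * (a - b) + p * ((x - y) * b).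
Proof. by rewrite !mulrBl !mulrBr !mulrA addrA subrK. Qed.

(** * Adjoints and unitary matrices *)

Section Dagger.
Variables (R : realType) (n : nat).
Local Notation C := (Cplx R).
Local Notation M := 'M[C]_n.+1.
Implicit Types (A B : M).

Lemma daggerE A i j : dagger A i j = (A j i)^*.
Proof. by rewrite !mxE conjc_conjC. Qed.

Lemma daggerK A : dagger (dagger A) = A.
Proof. by apply/matrixP => i j; rewrite !daggerE conjCK. Qed.

Lemma daggerD A B : dagger (A + B) = dagger A + dagger B.
Proof. by apply/matrixP => i j; rewrite !(daggerE, mxE) rmorphD. Qed.

Lemma daggerN A : dagger (- A) = - dagger A.
Proof. by apply/matrixP => i j; rewrite !(daggerE, mxE) rmorphN. Qed.

Lemma daggerB A B : dagger (A - B) = dagger A - dagger B.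
Proof. by rewrite daggerD daggerN. Qed.

Lemma dagger1 : dagger 1 = 1 :> M.
Proof. by apply/matrixP => i j; rewrite !(daggerE, mxE) eq_sym rmorph_nat. Qed.

Lemma daggerM A B : dagger (A * B) = dagger B * dagger A.
Proof.
apply/matrixP => i j; rewrite !(daggerE, mxE) rmorph_sum.
by apply: eq_bigr => k _; rewrite !daggerE rmorphM mulrC.
Qed.

Lemma daggerZ (r : R) A : dagger ((r%:C : C) *: A) = (r%:C : C) *: dagger A.
Proof.
apply/matrixP => i j; rewrite !(daggerE, mxE) rmorphM; congr (_ * _).
exact: conjc_real.
Qed.

Lemma unitaryV A : unitary A -> dagger A * A = 1.
Proof. by move=> uA; apply: mulmx1C. Qed.

Lemma unitary_dagger A : unitary A -> unitary (dagger A).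
Proof. by move=> uA; rewrite /unitary /= daggerK; exact: unitaryV. Qed.

Lemma unitaryM A B : unitary A -> unitary B -> unitary (A * B).
Proof.
by move=> uA uB; rewrite /unitary /= daggerM mulrA -(mulrA A) uB mulr1.
Qed.

Lemma unitary1 : unitary (1 : M).
Proof. by rewrite /unitary /= dagger1 mulr1. Qed.

Lemma unitaryX A k : unitary A -> unitary (A ^+ k).
Proof.
move=> uA; elim: k => [|k IH]; first by rewrite expr0; exact: unitary1.
by rewrite exprS; exact: unitaryM.
Qed.

End Dagger.

(** * The maximum norm with real values *)

Section RealNorm.
Variables (R : realType) (n : nat).
Local Notation C := (Cplx R).
Local Notation M := 'M[C]_n.+1.
Implicit Types (A B : M).

(* The norm of [M] takes its values in [C]; [nr] is the same number in [R]. *)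
Definition nr A : R := complex.Re `|A|.

Lemma nrE A : (nr A)%:C = `|A|.
Proof. by rewrite /nr RRe_real// normr_real. Qed.

Lemma nr_ge0 A : 0 <= nr A.
Proof. by rewrite -ler0c nrE. Qed.

Lemma nr0 : nr 0 = 0.
Proof. by rewrite /nr normr0. Qed.

Lemma nrN A : nr (- A) = nr A.
Proof. by rewrite /nr normrN. Qed.

Lemma nr_eq0 A : nr A = 0 -> A = 0.
Proof. by move=> h; apply: normr0_eq0; rewrite -nrE h. Qed.

Lemma ler_nrD A B : nr (A + B) <= nr A + nr B.
Proof. by rewrite -lecR rmorphD /= !nrE; exact: ler_normD. Qed.

Lemma nrZ (r : R) A : nr ((r%:C : C) *: A) = `|r| * nr A.
Proof.
apply: complexI; rewrite nrE rmorphM/= nrE normrZ; congr (_ * _).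
by rewrite normc_def /= expr0n /= addr0 sqrtr_sqr.
Qed.

(** The norm is the maximum of the moduli of the entries, so an upper bound on [nr] reduces to a
    bound on a single entry. *)
Lemma nr_attained A : exists i j, (nr A)%:C = `|A i j|.
Proof.
have [A0|/mx_norm_neq0[[i j] /= h]] := eqVneq `|A| 0.
  exists ord0, ord0; rewrite nrE A0.
  by move/eqP: A0; rewrite normr_eq0 => /eqP->; rewrite mxE normr0.
by exists i, j; rewrite nrE -h.
Qed.

Lemma norm_entry_le A i j : `|A i j| <= (nr A)%:C.
Proof.
rewrite nrE [leRHS]/Num.Def.normr /= mx_normE.
by rewrite -[leLHS]nngE num_le; exact: (le_bigmax _ _ (i, j)).
Qed.

(** The maximum norm is not submultiplicative: each entry of a product is a sum of [n.+1] terms,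
    whence the factor. *)
Lemma nrM A B : nr (A * B) <= n.+1%:R * (nr A * nr B).
Proof.
have [i [j nAB]] := nr_attained (A * B).
rewrite -lecR nAB mxE (le_trans (ler_norm_sum _ _ _))//.
rewrite !rmorphM rmorph_nat/= -[X in X%:R]card_ord mulr_natl -sumr_const.
by apply: ler_sum => k _; rewrite normrM ler_pM// norm_entry_le.
Qed.

(** The squared moduli in each row of a unitary matrix add up to 1. *)
Lemma nr_unitary A : unitary A -> nr A <= 1.
Proof.
move=> uA; have [i [j nA]] := nr_attained A.
rewrite -lecR nA -[leRHS]/(1 : C) -(@expr_le1 _ 2)//.
have <- : (A * dagger A) i i = 1 by rewrite uA mxE eqxx.
rewrite mxE (bigD1 j)//= daggerE -normCK lerDl sumr_ge0// => k _.
by rewrite daggerE -normCK exprn_ge0.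
Qed.

Lemma nr_unitaryMl P A : unitary P -> nr (P * A) <= n.+1%:R * nr A.
Proof.
move=> uP; rewrite (le_trans (nrM _ _))// ler_wpM2l//.
by rewrite ler_piMl ?nr_ge0// nr_unitary.
Qed.

Lemma nr_unitaryMr P A : unitary P -> nr (A * P) <= n.+1%:R * nr A.
Proof.
move=> uP; rewrite (le_trans (nrM _ _))// ler_wpM2l//.
by rewrite ler_piMr ?nr_ge0// nr_unitary.
Qed.

(* The free unitary factor [P] absorbs the [A] that each step splits off, so the
   dimension constant does not accumulate. *)
Lemma nr_unitary_exprB P A B k : unitary P -> unitary A -> unitary B ->
  nr (P * (A ^+ k - B ^+ k)) <= k%:R * (n.+1%:R ^+ 2 * nr (A - B)).
Proof.
move=> uP uA uB; elim: k P uP => [|k IH] P uP.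
  by rewrite !expr0 subrr mulr0 nr0 mul0r.
have -> : P * (A ^+ k.+1 - B ^+ k.+1) =
    P * A * (A ^+ k - B ^+ k) + P * ((A - B) * B ^+ k).
  by rewrite !exprS; exact: mulrBM_split.
rewrite (le_trans (ler_nrD _ _))// -natr1 [leRHS]mulrDl [1 * _]mul1r.
apply: lerD; first by apply: IH; exact: unitaryM.
rewrite (le_trans (nr_unitaryMl _ uP))// expr2 -mulrA ler_wpM2l//.
by apply: nr_unitaryMr; exact: unitaryX.
Qed.

Lemma nr_exprB A B k : unitary A -> unitary B ->
  nr (A ^+ k - B ^+ k) <= k%:R * (n.+1%:R ^+ 2 * nr (A - B)).
Proof.
move=> uA uB; rewrite -[X in nr X]mul1r.
by apply: nr_unitary_exprB => //; exact: unitary1.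
Qed.

End RealNorm.

(** * Limits of matrices along a filter *)

Section Convergence.
Variables (R : realType) (n : nat) (T : Type) (F : set_system T).
Context {FF : Filter F}.
Local Notation C := (Cplx R).
Local Notation M := 'M[C]_n.+1.
Implicit Types (f g : T -> M) (A B : M).

Lemma cvg_mx_unique (PF : ProperFilter F) f A B :
  f @ F --> A -> f @ F --> B -> A = B.
Proof. by move=> fA fB; exact: (cvg_unique (@norm_hausdorff C M) fA fB). Qed.

Lemma cvg_nrP f A : f @ F --> A <-> (fun x => nr (f x - A)) @ F --> (0 : R).
Proof.
split=> [/cvgrPdist_lt fA|/cvgrPdist_lt fA]; apply/cvgrPdist_lt => e e0.
  have := fA e%:C; rewrite ltcR => /(_ e0); apply: filterS => x /=.
  by rewrite -nrE ltcR -nrN opprB sub0r normrN ger0_norm// nr_ge0.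
(* Positivity in the order of [C] forces [e] to be real, so the convergence in [R] applies to it. *)
have eE : e = (complex.Re e)%:C by rewrite RRe_real// gtr0_real.
move: e0; rewrite eE ltcR => e0; have := fA _ e0; apply: filterS => x /=.
by rewrite -nrE ltcR -nrN opprB sub0r normrN ger0_norm// nr_ge0.
Qed.

Lemma cvg_entryP f A :
  f @ F --> A <-> forall i j, (fun x => f x i j) @ F --> A i j.
Proof.
split=> [/cvgrPdist_lt fA i j|fA]; apply/cvgrPdist_lt => e e0.
  apply: filterS (fA e e0) => x; apply: le_lt_trans.
  by have := norm_entry_le (A - f x) i j; rewrite nrE !mxE.
have : \near F, forall i j, `|A i j - f F i j| < e.
  apply: filter_forall => i; apply: filter_forall => j.
  by have /cvgrPdist_lt := fA i j; exact.
apply: filterS => x h; rewrite -nrE.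
by have [i [j ->]] := nr_attained (A - f x); rewrite !mxE.
Qed.

Lemma cvg_mxD f g A B :
  f @ F --> A -> g @ F --> B -> (fun x => f x + g x) @ F --> A + B.
Proof. by move=> fA gB; exact: (@cvgD C M T F FF f g A B fA gB). Qed.

Lemma cvg_mxB f g A B :
  f @ F --> A -> g @ F --> B -> (fun x => f x - g x) @ F --> A - B.
Proof. by move=> fA gB; exact: (@cvgB C M T F FF f g A B fA gB). Qed.

Lemma cvg_mx_cst A : (fun=> A) @ F --> A.
Proof. exact: cvg_cst. Qed.

Lemma cvg_mxM f g A B :
  f @ F --> A -> g @ F --> B -> (fun x => f x * g x) @ F --> A * B.
Proof.
move=> /cvg_entryP fA /cvg_entryP gB; apply/cvg_entryP => i j.
have -> : (fun x => (f x * g x) i j) = (fun x => \sum_k f x i k * g x k j).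
  by apply/funext => x; rewrite mxE.
rewrite mxE; apply: cvg_big => [|k _]; first exact: add_continuous.
by apply: cvgM.
Qed.

Lemma cvg_realC (u : T -> R) (a : R) :
  u @ F --> a -> (fun x => (u x)%:C : C) @ F --> (a%:C : C).
Proof.
move=> /cvgrPdist_lt ua; apply/cvgrPdist_lt => e e0.
have eE : e = (complex.Re e)%:C by rewrite RRe_real// gtr0_real.
move: e0; rewrite eE ltcR => e0; have := ua _ e0; apply: filterS => x.
by rewrite -rmorphB /= normc_def /= expr0n /= addr0 sqrtr_sqr ltcR.
Qed.

Lemma cvg_mxZ (u : T -> R) (a : R) f A : u @ F --> a -> f @ F --> A ->
  (fun x => ((u x)%:C : C) *: f x) @ F --> (a%:C : C) *: A.
Proof.
by move=> /cvg_realC ua fA; exact: (@cvgZ C M T F FF (fun x => (u x)%:C : C)).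
Qed.

Lemma cvg_complex (u : T -> C) (a : C) :
  (fun x => complex.Re (u x)) @ F --> complex.Re a ->
  (fun x => complex.Im (u x)) @ F --> complex.Im a -> u @ F --> a.
Proof.
move=> /cvg_realC ur /cvg_realC ui.
pose mkC (x y : R) : C := (x%:C : C) + ('i : C) * (y%:C : C).
have mkCE (z : C) : mkC (complex.Re z) (complex.Im z) = z.
  by rewrite [RHS]complexE.
rewrite -(mkCE a) -(funext (fun x => mkCE (u x))).
apply: (@cvgD C C^o T F FF _ _ _ _ ur).
exact: (@cvgM C T F FF _ _ _ _ (cvg_cst ('i : C)) ui).
Qed.

Lemma cvg_Re (u : T -> C) (a : C) : u @ F --> a ->
  (fun x => complex.Re (u x)) @ F --> complex.Re a.
Proof.
move=> /cvgrPdist_lt ua; apply/cvgrPdist_lt => e e0.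
have := ua e%:C; rewrite ltcR => /(_ e0); apply: filterS => x.
rewrite normc_def ltcR; apply: le_lt_trans.
have -> : complex.Re a - complex.Re (u x) = complex.Re (a - u x).
  by case: (a) (u x) => ? ? [].
by rewrite -sqrtr_sqr ler_wsqrtr// lerDl sqr_ge0.
Qed.

Lemma cvg_conj (u : T -> C) (a : C) : u @ F --> a ->
  (fun x => (u x)^*) @ F --> a^*.
Proof.
move=> /cvgrPdist_lt ua; apply/cvgrPdist_lt => e e0.
by have := ua e e0; apply: filterS => x; rewrite -rmorphB norm_conjC.
Qed.

Lemma cvg_dagger f A : f @ F --> A -> (fun x => dagger (f x)) @ F --> dagger A.
Proof.
move=> /cvg_entryP fA; apply/cvg_entryP => i j.
have -> : (fun x => dagger (f x) i j) = (fun x => (f x j i)^*).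
  by apply/funext => x; rewrite daggerE.
by rewrite daggerE; exact: cvg_conj.
Qed.

Lemma cvg_nr f A : f @ F --> A -> (fun x => nr (f x)) @ F --> nr A.
Proof. by move=> fA; apply: cvg_Re; exact: cvg_norm. Qed.

End Convergence.

(** * Scalar exponential series and the unit circle *)

Section ExpSeries.
Variable R : realType.
Local Notation C := (Cplx R).

(** The series is dominated by that of [expR b]. Beyond the terms of order 0 and 1, [t <= 1] allows
    [t ^+ 2] to be factored out, and what remains is a tail of the series of [expR b]. *)
Lemma real_exp_series_bound (a : nat -> R) (b t : R) :
  (forall k, `|a k| <= b ^+ k) -> 0 <= t <= 1 ->
  exists2 l, (fun m => \sum_(k < m) k`!%:R^-1 * (t ^+ k * a k)) @ \oo --> l &
    `|l - (a 0%N + t * a 1%N)| <= t ^+ 2 * expR b.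
Proof.
move=> ab /andP[t0 t1]; have b0 : 0 <= b.
  by have := ab 1%N; rewrite expr1; apply: le_trans.
pose u k : R := k`!%:R^-1 * (t ^+ k * a k).
have uE : (fun m => \sum_(k < m) k`!%:R^-1 * (t ^+ k * a k)) = series u.
  by apply/funext => m; rewrite /series /= big_mkord.
have u_le k : `|u k| <= t ^+ k * exp_coeff b k.
  rewrite /u /exp_coeff /= !normrM mulrCA (ger0_norm (exprn_ge0 _ t0)).
  rewrite ler_wpM2l ?exprn_ge0// mulrC normfV normr_nat.
  by rewrite ler_wpM2r ?invr_ge0.
have cu : cvgn (series u).
  apply: normed_cvg; apply: series_le_cvg (is_cvg_series_exp_coeff b) => k //=.
    by rewrite /exp_coeff /= divr_ge0// exprn_ge0.
  rewrite (le_trans (u_le k))// ler_piMl ?exprn_ile1//.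
  by rewrite /exp_coeff /= divr_ge0// exprn_ge0.
rewrite uE; exists (limn (series u)) => //.
have cn : (fun m => `|series u (m + 2)%N - (a 0%N + t * a 1%N)|) @ \oo -->
    `|limn (series u) - (a 0%N + t * a 1%N)|.
  apply: cvg_norm; apply: cvgB; last exact: cvg_cst.
  by rewrite (cvg_shiftn 2 (series u)).
apply: (ler_cvg_to cn (cvg_cst (t ^+ 2 * expR b))).
apply: nearW => m.
have -> : series u (m + 2)%N - (a 0%N + t * a 1%N) = \sum_(k < m) u k.+2.
  rewrite /series /= addn2 big_mkord !big_ord_recl /= /u /bump /=.
  rewrite addn0 fact0 (_ : 1`! = 1)%N// expr0 expr1 invr1 !mul1r addrA.
  rewrite [LHS]addrAC subrr add0r.
  by apply: eq_bigr => i _; rewrite !add1n.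
rewrite (le_trans (ler_norm_sum _ _ _))//.
(* All coefficients are nonnegative, so restoring the first two terms gives a partial sum below the
   limit. *)
have sE : \sum_(k < m) exp_coeff b k.+2 <= expR b.
  have c0 k : 0 <= exp_coeff b k.
    by rewrite /exp_coeff /= divr_ge0// exprn_ge0.
  have nd : {homo series (exp_coeff b) : i j / (i <= j)%N >-> i <= j}.
    by apply/nondecreasing_seqP => k; rewrite /series /= big_nat_recr//= lerDl.
  apply: le_trans
    (nondecreasing_cvgn_le nd (is_cvg_series_exp_coeff b) (m + 2)).
  rewrite /series /= addn2 big_mkord !big_ord_recl addrA.
  by rewrite -[leLHS]add0r lerD// addr_ge0.
rewrite (le_trans _ (ler_wpM2l (exprn_ge0 2 t0) sE))// mulr_sumr.
apply: ler_sum => k _; rewrite (le_trans (u_le _))// ler_wpM2r//.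
  by rewrite /exp_coeff /= divr_ge0// exprn_ge0.
by rewrite -addn2 exprD ler_piMl ?exprn_ge0// exprn_ile1.
Qed.

Lemma ReM_real (r : R) (z : C) : complex.Re (r%:C * z) = r * complex.Re z.
Proof. by case: z => x y /=; rewrite mul0r subr0. Qed.

Lemma ImM_real (r : R) (z : C) : complex.Im (r%:C * z) = r * complex.Im z.
Proof. by case: z => x y /=; rewrite mul0r addr0. Qed.

Lemma Re_sum (I : Type) (s : seq I) (f : I -> C) :
  complex.Re (\sum_(i <- s) f i) = \sum_(i <- s) complex.Re (f i).
Proof. by apply: (@big_morph _ _ (@complex.Re R)) => // -[x y] [x' y']. Qed.

Lemma Im_sum (I : Type) (s : seq I) (f : I -> C) :
  complex.Im (\sum_(i <- s) f i) = \sum_(i <- s) complex.Im (f i).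
Proof. by apply: (@big_morph _ _ (@complex.Im R)) => // -[x y] [x' y']. Qed.

Lemma normRe_le (z : C) (c : R) : `|z| <= c%:C -> `|complex.Re z| <= c.
Proof.
rewrite normc_def lecR; apply: le_trans.
by rewrite -sqrtr_sqr ler_wsqrtr// lerDl sqr_ge0.
Qed.

Lemma normIm_le (z : C) (c : R) : `|z| <= c%:C -> `|complex.Im z| <= c.
Proof.
rewrite normc_def lecR; apply: le_trans.
by rewrite -sqrtr_sqr ler_wsqrtr// lerDr sqr_ge0.
Qed.

Lemma normC_le (z : C) (c d : R) : `|complex.Re z| <= c ->
  `|complex.Im z| <= d -> `|z| <= (c + d)%:C.
Proof.
move=> hc hd; rewrite normc_def lecR.
rewrite -(ger0_norm (_ : 0 <= c + d)); last first.
  by rewrite addr_ge0// (le_trans _ hc, le_trans _ hd).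
rewrite -sqrtr_sqr ler_wsqrtr//.
rewrite -(real_normK (num_real (complex.Re z))).
rewrite -(real_normK (num_real (complex.Im z))).
have := normr_ge0 (complex.Re z); have := normr_ge0 (complex.Im z); nra.
Qed.

(** Real and imaginary parts are bounded separately; each contributes one [expR b]. *)
Lemma complex_exp_series_bound (a : nat -> C) (b t : R) :
  (forall k, `|a k| <= (b ^+ k)%:C) -> 0 <= t <= 1 ->
  exists2 l : C,
    (fun m => \sum_(k < m) (k`!%:R^-1 : C) * (((t ^+ k)%:C : C) * a k)) @ \oo
      --> l &
    `|l - (a 0%N + (t%:C : C) * a 1%N)| <= (t ^+ 2 * (expR b + expR b))%:C.
Proof.
move=> ab t01.
have [r cr hr] := real_exp_series_bound (fun k => normRe_le (ab k)) t01.
have [s cs hs] := real_exp_series_bound (fun k => normIm_le (ab k)) t01.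
have natC k : (k`!%:R^-1 : C) = (k`!%:R^-1)%:C by rewrite fmorphV rmorph_nat.
exists (Complex r s); first apply: cvg_complex => /=.
- apply: cvg_trans cr; apply: near_eq_cvg; apply: nearW => m.
  by rewrite Re_sum; apply: eq_bigr => k _; rewrite natC !ReM_real.
- apply: cvg_trans cs; apply: near_eq_cvg; apply: nearW => m.
  by rewrite Im_sum; apply: eq_bigr => k _; rewrite natC !ImM_real.
rewrite mulrDr; apply: normC_le.
  apply: le_trans hr; rewrite -ReM_real.
  by case: (a 0%N) (_ * a 1%N) => ? ? [].
apply: le_trans hs; rewrite -ImM_real.
by case: (a 0%N) (_ * a 1%N) => ? ? [].
Qed.

Lemma expi_series (x : R) :
  (fun m => \sum_(k < m) (k`!%:R^-1 : C) * ('i * (x%:C : C)) ^+ k) @ \oo -->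
  expi x.
Proof.
have natC k : (k`!%:R^-1 : C) = (k`!%:R^-1)%:C by rewrite fmorphV rmorph_nat.
(* Parity stays a factor 0 or 1, and the odd case uses [k.-1./2], to match the shape of [cos_coeff]
   and [sin_coeff]. *)
have iX k : ('i : C) ^+ k = Complex ((~~ odd k)%:R * (-1) ^+ k./2)
    ((odd k)%:R * (-1) ^+ k.-1./2).
  rewrite -{1}(odd_double_half k) exprD -mul2n exprM sqrCi.
  have -> : (-1) ^+ k./2 = ((-1) ^+ k./2)%:C :> C.
    by rewrite rmorphXn rmorphN rmorph1.
  case: (boolP (odd k)) => ok /=.
    have -> : k.-1./2 = k./2 by rewrite -[in LHS](odd_double_half k) ok doubleK.
    by rewrite expr1 imaginaryE; apply/eqP; rewrite eq_complex /=; apply/andP;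
       split; apply/eqP; ring.
  by rewrite expr0 mul1r !mul1r !mul0r.
have tE k : (k`!%:R^-1 : C) * ('i * (x%:C : C)) ^+ k =
    Complex (cos_coeff x k) (sin_coeff x k).
  rewrite natC exprMn iX -rmorphXn; apply/eqP; rewrite eq_complex /=.
  by apply/andP; split; apply/eqP; rewrite /cos_coeff /sin_coeff /=
    -?exprnP; ring.
have -> : expi x = Complex (cos x) (sin x).
  rewrite /expi imaginaryE; apply/eqP; rewrite eq_complex /=.
  by apply/andP; split; apply/eqP; ring.
apply: cvg_complex => /=.
  have h : series (cos_coeff x) @ \oo --> cos x.
    by rewrite cos.unlock; exact: is_cvg_series_cos_coeff.
  apply: cvg_trans h.
  apply: near_eq_cvg; apply: nearW => m.
  by rewrite Re_sum /series /= big_mkord; apply: eq_bigr => k _; rewrite tE.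
have h : series (sin_coeff x) @ \oo --> sin x.
  by rewrite sin.unlock; exact: is_cvg_series_sin_coeff.
apply: cvg_trans h.
apply: near_eq_cvg; apply: nearW => m.
by rewrite Im_sum /series /= big_mkord; apply: eq_bigr => k _; rewrite tE.
Qed.

Lemma expiD (x y : R) : expi (x + y) = expi x * expi y.
Proof.
rewrite /expi cosD sinD imaginaryE; apply/eqP; rewrite eq_complex /=.
by apply/andP; split; apply/eqP; ring.
Qed.

Lemma expi0 : expi 0 = 1 :> C.
Proof. by rewrite /expi cos0 sin0 mulr0 addr0. Qed.

Lemma conj_expi (x : R) : (expi x)^* = expi (- x).
Proof.
rewrite /expi cosN sinN imaginaryE -conjc_conjC; apply/eqP.
by rewrite eq_complex /=; apply/andP; split; apply/eqP; ring.
Qed.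

Lemma cvg_expi (T : Type) (F : set_system T) {FF : Filter F} (u : T -> R)
  (a : R) : u @ F --> a -> (fun x => expi (u x)) @ F --> expi a.
Proof.
move=> ua; have E y : expi y = Complex (cos y) (sin y).
  rewrite /expi imaginaryE; apply/eqP; rewrite eq_complex /=.
  by apply/andP; split; apply/eqP; ring.
apply: cvg_complex.
  under eq_fun do rewrite E; rewrite E /=.
  by apply: continuous_cvg => //; exact: continuous_cos.
under eq_fun do rewrite E; rewrite E /=.
by apply: continuous_cvg => //; exact: continuous_sin.
Qed.

End ExpSeries.

(** * First-order expansion of the matrix exponential *)

Section MatrixExp.
Variables (R : realType) (n : nat).
Local Notation C := (Cplx R).
Local Notation M := 'M[C]_n.+1.
Implicit Types (A B X P : M).

Lemma nrX X (c : R) k : nr X <= c -> nr (X ^+ k) <= (n.+1%:R * c) ^+ k.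
Proof.
move=> Xc; have c0 : 0 <= c by apply: le_trans Xc; exact: nr_ge0.
elim: k => [|k IH]; first by rewrite !expr0; apply: nr_unitary; exact: unitary1.
rewrite !exprS (le_trans (nrM _ _))// -mulrA ler_wpM2l// ler_pM// ?nr_ge0//.
Qed.

(** The scalar bound is applied to each entry, with [a k = (X ^+ k) i j] and [b = n.+1%:R * c]. The
    error depends on [X] only through [c], which later allows [X] to vary with the parameter. *)
Lemma expm_bound X (c t : R) : nr X <= c -> 0 <= t <= 1 ->
  nr (expm ((t%:C : C) *: X) - (1 + (t%:C : C) *: X)) <=
  t ^+ 2 * (expR (n.+1%:R * c) + expR (n.+1%:R * c)).
Proof.
move=> Xc t01.
have Xb i j k : `|(X ^+ k) i j| <= ((n.+1%:R * c) ^+ k)%:C.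
  by rewrite (le_trans (norm_entry_le _ i j))// lecR nrX.
have /choice[L HL] : forall ij : 'I_n.+1 * 'I_n.+1, exists l : C,
    (fun m => \sum_(k < m) (k`!%:R^-1 : C) *
       (((t ^+ k)%:C : C) * (X ^+ k) ij.1 ij.2)) @ \oo --> l /\
    `|l - ((X ^+ 0) ij.1 ij.2 + (t%:C : C) * (X ^+ 1) ij.1 ij.2)| <=
    (t ^+ 2 * (expR (n.+1%:R * c) + expR (n.+1%:R * c)))%:C.
  move=> [i j].
  by have [l] := complex_exp_series_bound (Xb i j) t01; exists l.
have cL : (fun m => \sum_(k < m) (k`!%:R^-1 : C) *: ((t%:C : C) *: X) ^+ k)
    @ \oo --> (\matrix_(i, j) L (i, j) : M).
  apply/cvg_entryP => i j; rewrite mxE.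
  have [h _] := HL (i, j); apply: cvg_trans h; apply: near_eq_cvg.
  apply: nearW => m; rewrite summxE; apply: eq_bigr => k _.
  by rewrite exprZn !mxE rmorphXn.
(* [expm] is a bare [lim], so it is identified only now that the series is known to converge. *)
have -> : expm ((t%:C : C) *: X) = \matrix_(i, j) L (i, j).
  by apply: cvg_lim => //; exact: norm_hausdorff.
rewrite -lecR.
have [i [j ->]] := nr_attained (\matrix_(i, j) L (i, j) - (1 + t%:C *: X)).
by have [_] := HL (i, j); rewrite expr0 expr1 /= !mxE.
Qed.

End MatrixExp.

(** * Functional calculus in a unitary eigenbasis *)

Section Spectral.
Variables (R : realType) (n : nat).
Local Notation C := (Cplx R).
Local Notation M := 'M[C]_n.+1.
Implicit Types (A B X P : M) (d e : 'I_n.+1 -> C).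

(** For unitary [P] this is the normal matrix with eigenvalues [d] on the columns of [dagger P].
    With [P] fixed, pointwise operations on [d] become matrix operations. *)
Definition spec P d : M := dagger P * diag_mx (\row_j d j) * P.

Lemma conj_mulE P A B : unitary P ->
  (dagger P * A * P) * (dagger P * B * P) = dagger P * (A * B) * P.
Proof. by move=> uP; rewrite !mulrA -(mulrA _ P) uP mulr1. Qed.

Lemma conj_inj P A B : unitary P ->
  dagger P * A * P = dagger P * B * P -> A = B.
Proof.
move=> uP /(congr1 (fun Z => P * Z * dagger P)).
by rewrite /= !mulrA uP !mul1r -!mulrA uP !mulr1.
Qed.

Lemma specM P d e : unitary P ->
  spec P d * spec P e = spec P (fun j => d j * e j).
Proof.
move=> uP; rewrite /spec (conj_mulE _ _ uP); congr (_ * _ * _).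
rewrite -[LHS]/(_ *m _) mulmx_diag; congr diag_mx.
by apply/rowP => j; rewrite !mxE.
Qed.

Lemma spec1 P : unitary P -> spec P (fun=> 1) = 1.
Proof.
move=> uP; rewrite /spec (_ : diag_mx _ = 1) ?mulr1 ?unitaryV//.
by apply/matrixP => i j; rewrite !mxE.
Qed.

Lemma specD P d e : spec P (fun j => d j + e j) = spec P d + spec P e.
Proof.
rewrite /spec -mulrDl -mulrDr; congr (_ * _ * _).
by apply/matrixP => i j; rewrite !mxE mulrnDl.
Qed.

Lemma specZ P (c : C) d : spec P (fun j => c * d j) = c *: spec P d.
Proof.
have -> : spec P (fun j => c * d j) =
    dagger P * (c *: diag_mx (\row_j d j)) * P.
  by congr (_ * _ * _); apply/matrixP => i j; rewrite !mxE mulrnAr.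
by rewrite -scalerAr -scalerAl.
Qed.

Lemma spec_sum P m (f : 'I_m -> 'I_n.+1 -> C) :
  spec P (fun j => \sum_k f k j) = \sum_k spec P (f k).
Proof.
rewrite /spec -mulr_suml -mulr_sumr; congr (_ * _ * _).
apply/matrixP => i j; rewrite !(mxE, summxE) -sumrMnl.
by apply: eq_bigr => k _; rewrite !mxE.
Qed.

Lemma specX P d k : unitary P -> spec P d ^+ k = spec P (fun j => d j ^+ k).
Proof.
move=> uP; elim: k => [|k IH]; first by rewrite expr0 spec1.
rewrite exprS IH (specM _ _ uP); congr (spec P _).
by apply/funext => j; rewrite exprS.
Qed.

Lemma dagger_spec P d : dagger (spec P d) = spec P (fun j => (d j)^*).
Proof.
rewrite /spec !daggerM daggerK mulrA; congr (_ * _ * _).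
apply/matrixP => i j; rewrite daggerE !mxE eq_sym.
by case: eqVneq => [->|_]; rewrite ?mulr1n // !mulr0n rmorph0.
Qed.

Lemma cvg_spec (T : Type) (F : set_system T) {FF : Filter F} P
    (f : T -> 'I_n.+1 -> C) d :
  (forall j, (fun x => f x j) @ F --> d j) ->
  (fun x => spec P (f x)) @ F --> spec P d.
Proof.
move=> fd; apply: cvg_mxM; last exact: cvg_cst.
apply: cvg_mxM; first exact: cvg_cst.
apply/cvg_entryP => i j.
case: (eqVneq i j) => [->|ij].
  rewrite !mxE eqxx mulr1n.
  by under eq_fun do rewrite !mxE eqxx mulr1n; exact: fd.
rewrite !mxE (negbTE ij) mulr0n.
by under eq_fun do rewrite !mxE (negbTE ij) mulr0n; exact: cvg_cst.
Qed.

(** In the eigenbasis both products are entrywise multiplications, by [d i] on the left and [e j] on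
    the right. Two functions are allowed so that one criterion serves commutation, the eigenvector
    equation of [ad] and rotation by a phase. *)
Lemma spec_intertwine P A d e : unitary P ->
  spec P d * A = A * spec P e <->
  forall i j, d i * (P * A * dagger P) i j = (P * A * dagger P) i j * e j.
Proof.
move=> uP; have uV := unitaryV uP; set B := P * A * dagger P.
have -> : A = dagger P * B * P.
  by rewrite /B !mulrA uV mul1r -mulrA uV mulr1.
rewrite /spec (conj_mulE _ B uP) (conj_mulE B _ uP); clearbody B.
have dB i j : (diag_mx (\row_j d j) * B) i j = d i * B i j.
  by rewrite -[_ * B]/(diag_mx (\row_j d j) *m B) mul_diag_mx !mxE.
have Be i j : (B * diag_mx (\row_j e j)) i j = B i j * e j.
  by rewrite -[B * _]/(B *m diag_mx (\row_j e j)) mul_mx_diag !mxE.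
split=> [/(conj_inj uP)/matrixP h i j|h]; first by rewrite -dB h Be.
by congr (_ * _ * _); apply/matrixP => i j; rewrite dB Be.
Qed.

Lemma trmxC_dagger A : map_mx (@Num.conj C) A^T = dagger A.
Proof. by apply/matrixP => i j; rewrite daggerE !mxE. Qed.

(** A skew-Hermitian matrix is normal, hence unitarily diagonalizable, and [X + dagger X = 0] makes
    its eigenvalues imaginary. *)
Lemma skew_spectral X : skew_hermitian X ->
  exists P (l : 'I_n.+1 -> R),
    unitary P /\ X = spec P (fun j => 'i * ((l j)%:C : C)).
Proof.
move=> sX.
have nX : X \is normalmx.
  apply/normalmxP; by rewrite trmxC_dagger sX mulmxN mulNmx.
have /orthomx_spectralP := nX.
set P := spectralmx X; set sp := spectral_diag X => XE.
have uP : unitary P.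
  by have /unitarymxP := spectral_unitarymx X; rewrite trmxC_dagger.
have iP : invmx P = dagger P.
  by rewrite (invmx_unitary (spectral_unitarymx X)) trmxC_dagger.
have {}XE : X = spec P (fun j => sp 0 j).
  rewrite XE iP /spec (_ : \row_j _ = sp)//.
  by apply/rowP => j; rewrite mxE.
exists P, (fun j => complex.Im (sp 0 j)); split; first exact: uP.
rewrite [LHS]XE; congr (spec P _); apply/funext => j.
suff re0 : complex.Re (sp 0 j) = 0.
  by rewrite [LHS]complexE re0 add0r.
(* The factors 1 give the equation the form of [spec_intertwine] with [A = 1]; the diagonal entries
   then yield the scalar identities. *)
have : spec P (fun j => sp 0 j + (sp 0 j)^*) * 1 = 1 * spec P (fun=> 0).
  rewrite mulr1 mul1r specD -dagger_spec -XE sX subrr.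
  rewrite /spec (_ : diag_mx _ = 0) ?mulr0 ?mul0r//.
  by apply/matrixP => a b; rewrite !mxE mul0rn.
move/(spec_intertwine _ _ _ uP)/(_ j j).
rewrite mulr1 uP mxE eqxx mulr1 mulr0 -conjc_conjC.
by case: (sp 0 j) => a b [] /eqP; rewrite -mulr2n mulrn_eq0 /= => /eqP.
Qed.

Lemma expm_spec P (l : 'I_n.+1 -> R) (t : R) : unitary P ->
  expm ((t%:C : C) *: spec P (fun j => 'i * ((l j)%:C : C))) =
  spec P (fun j => expi (t * l j)).
Proof.
move=> uP; apply: cvg_lim; first exact: norm_hausdorff.
rewrite (_ : (fun m => _) = (fun m => spec P (fun j =>
    \sum_(k < m) (k`!%:R^-1 : C) * ('i * ((t * l j)%:C : C)) ^+ k))).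
  by apply: cvg_spec => j; exact: expi_series.
apply/funext => m; rewrite spec_sum; apply: eq_bigr => k _.
rewrite -specZ (specX _ _ uP) -specZ; apply: (congr1 (spec P)).
by apply/funext => j; rewrite rmorphM /= mulrCA.
Qed.

End Spectral.

(** * One-parameter groups of skew-Hermitian matrices *)

Section SkewExp.
Variables (R : realType) (n : nat).
Local Notation C := (Cplx R).
Local Notation M := 'M[C]_n.+1.
Implicit Types (A B X U : M).

Lemma expm_unitary X (t : R) : skew_hermitian X ->
  unitary (expm ((t%:C : C) *: X)).
Proof.
move=> /skew_spectral[P [l [uP ->]]].
rewrite (expm_spec _ _ uP) /unitary /= dagger_spec (specM _ _ uP) -(spec1 uP).
congr (spec P _); apply/funext => j.
by rewrite conj_expi -expiD subrr expi0.
Qed.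

Lemma expm_dagger X (t : R) : skew_hermitian X ->
  dagger (expm ((t%:C : C) *: X)) = expm (((- t)%:C : C) *: X).
Proof.
move=> /skew_spectral[P [l [uP ->]]].
rewrite !(expm_spec _ _ uP) dagger_spec.
by congr (spec P _); apply/funext => j; rewrite conj_expi mulNr.
Qed.

Lemma expm_natM X (t : R) k : skew_hermitian X ->
  expm ((t%:C : C) *: X) ^+ k = expm (((k%:R * t)%:C : C) *: X).
Proof.
move=> /skew_spectral[P [l [uP ->]]].
rewrite !(expm_spec _ _ uP) (specX _ _ uP).
congr (spec P _); apply/funext => j.
elim: k => [|k IH]; first by rewrite expr0 !mul0r expi0.
by rewrite exprS IH -expiD -natr1; congr expi; ring.
Qed.

Lemma cvg_expm (T : Type) (F : set_system T) {FF : Filter F} X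
    (u : T -> R) (a : R) : skew_hermitian X -> u @ F --> a ->
  (fun x => expm (((u x)%:C : C) *: X)) @ F --> expm ((a%:C : C) *: X).
Proof.
move=> /skew_spectral[P [l [uP ->]]] ua; rewrite (expm_spec _ _ uP).
under eq_fun do rewrite (expm_spec _ _ uP).
apply: cvg_spec => j; apply: cvg_expi; apply: cvgM => //; exact: cvg_cst.
Qed.

(** In the eigenbasis of [X], a nonzero entry of [A] at [(i, j)] forces [l i = l j], hence equal
    exponentials. *)
Lemma expm_comm X A (t : R) : skew_hermitian X -> X * A = A * X ->
  expm ((t%:C : C) *: X) * A = A * expm ((t%:C : C) *: X).
Proof.
move=> /skew_spectral[P [l [uP ->]]].
move=> /(spec_intertwine _ _ _ uP) h; rewrite (expm_spec _ _ uP).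
apply/(spec_intertwine _ _ _ uP) => i j; have := h i j.
have [->|B0] := eqVneq ((P * A * dagger P) i j) 0.
  by rewrite !mulr0 !mul0r.
rewrite mulrC => /(mulfI B0)/(mulfI (neq0Ci _))/complexI ->.
by rewrite mulrC.
Qed.

Lemma expm_conj X U (t : R) : skew_hermitian X -> unitary U ->
  expm ((t%:C : C) *: (U * X * dagger U)) =
  U * expm ((t%:C : C) *: X) * dagger U.
Proof.
move=> /skew_spectral[P [l [uP ->]]] uU.
have specU d : U * spec P d * dagger U = spec (P * dagger U) d.
  by rewrite /spec daggerM daggerK !mulrA.
have uPU : unitary (P * dagger U) := unitaryM uP (unitary_dagger uU).
by rewrite specU (expm_spec _ _ uP) (expm_spec _ _ uPU) specU.
Qed.

(** In the eigenbasis, [ad X] multiplies the entry [(i, j)] by ['i * (l i - l j)]. So [l i - l j]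
    takes the same value [mu] at all nonzero entries of [A], with [lam = 'i * mu], and conjugation
    by the exponential multiplies them all by the same phase. *)
Lemma ad_eigenvector_rotation X A (lam : C) : skew_hermitian X -> A != 0 ->
  lam != 0 -> ad X A = lam *: A ->
  exists2 mu : R, mu != 0 & forall t : R,
    expm ((t%:C : C) *: X) * A =
    expi (t * mu) *: (A * expm ((t%:C : C) *: X)).
Proof.
move=> /skew_spectral[P [l [uP ->]]] A0 lam0 adA.
set B := P * A * dagger P.
have hB i j : B i j != 0 -> lam = 'i * ((l i - l j)%:C : C).
  (* The eigenvector equation rewritten as [X * A = A * (X + lam)]. *)
  move=> Bij; have /(spec_intertwine _ _ _ uP)/(_ i j) :
    spec P (fun j => 'i * ((l j)%:C : C)) * A =
    A * spec P (fun j => 'i * ((l j)%:C : C) + lam).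
    rewrite specD mulrDr; move/eqP: adA; rewrite /ad subr_eq addrC => /eqP ->.
    congr (_ + _).
    have -> : spec P (fun=> lam) = lam *: 1.
      by rewrite -(spec1 uP) -specZ; congr (spec P _); apply/funext => ?;
         rewrite mulr1.
    by rewrite -scalerAr mulr1.
  rewrite -/B mulrC => /(mulfI Bij) h.
  by rewrite rmorphB mulrBr h addrAC subrr add0r.
have [i [j Bij]] : exists i j, B i j != 0.
  apply/not_existsP => h; move/negP: A0; apply; apply/eqP.
  have -> : A = dagger P * B * P.
    by rewrite /B !mulrA (unitaryV uP) mul1r -mulrA (unitaryV uP) mulr1.
  rewrite (_ : B = 0) ?mulr0 ?mul0r//; apply/matrixP => i j; rewrite [RHS]mxE.
  by apply/eqP; apply/negPn/negP => Bij; apply: (h i); exists j.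
exists (l i - l j).
  apply: contraNneq lam0 => l0; by rewrite (hB i j Bij) l0 mulr0.
move=> t; rewrite (expm_spec _ _ uP) scalerAr -specZ.
apply/(spec_intertwine _ _ _ uP) => a b; rewrite -/B.
have [->|Bab] := eqVneq (B a b) 0; first by rewrite mulr0 mul0r.
have := hB a b Bab; rewrite (hB i j Bij) => /(mulfI (neq0Ci _))/complexI ->.
by rewrite mulrC -expiD; congr (_ * expi _); ring.
Qed.

End SkewExp.

(** * Derivatives at the identity along a filter *)

Section DifferenceQuotient.
Variables (R : realType) (n : nat) (T : Type) (F : set_system T).
Context {FF : ProperFilter F}.
Variable s : T -> R.
Hypotheses (s_gt0 : forall x, 0 < s x) (s_cvg0 : s @ F --> (0 : R)).
Local Notation C := (Cplx R).
Local Notation M := 'M[C]_n.+1.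
Implicit Types (A B X Y : M) (U V : T -> M).

(** The limit of [dq U] plays the role of the tangent vector at 1. A general filter covers both the
    harmonic sequence and the ultrafilter used at the end. *)
Definition dq U x : M := (((s x)^-1)%:C : C) *: (U x - 1).

Lemma dqK U x : U x = 1 + ((s x)%:C : C) *: dq U x.
Proof.
rewrite /dq scalerA -rmorphM /= divff ?gt_eqF//.
by rewrite scale1r addrC subrK.
Qed.

Lemma dq_cvg1 U X : dq U @ F --> X -> U @ F --> (1 : M).
Proof.
move=> UX; rewrite (funext (dqK U)).
have h : (fun x => (1 : M) + ((s x)%:C : C) *: dq U x) @ F -->
    1 + ((0 : R)%:C : C) *: X.
  by apply: cvg_mxD (cvg_mxZ s_cvg0 UX); exact: cvg_mx_cst.
by rewrite scale0r addr0 in h.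
Qed.

Lemma cvg_dqM U V X Y : dq U @ F --> X -> dq V @ F --> Y ->
  dq (fun x => U x * V x) @ F --> X + Y.
Proof.
move=> UX VY; have V1 := dq_cvg1 VY.
rewrite (_ : dq _ = (fun x => dq U x * V x + dq V x)).
  have -> : X + Y = X * 1 + Y by rewrite mulr1.
  exact: cvg_mxD (cvg_mxM UX V1) VY.
apply/funext => x; rewrite /dq -scalerAl -scalerDr; congr (_ *: _).
by rewrite mulrBl mul1r addrA subrK.
Qed.

Lemma cvg_dq_dagger U X : dq U @ F --> X ->
  dq (fun x => dagger (U x)) @ F --> dagger X.
Proof.
move=> UX; rewrite (_ : dq _ = (fun x => dagger (dq U x))).
  exact: cvg_dagger.
by apply/funext => x; rewrite /dq daggerZ daggerB dagger1.
Qed.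

(** Differentiate [U * dagger U = 1]. *)
Lemma dq_skew U X : (forall x, unitary (U x)) -> dq U @ F --> X ->
  skew_hermitian X.
Proof.
move=> uU UX; have := cvg_dqM UX (cvg_dq_dagger UX).
rewrite (_ : dq _ = (fun=> 0)); last first.
  by apply/funext => x; rewrite /dq uU subrr scaler0.
move=> h; have XX : X + dagger X = 0.
  exact: (cvg_mx_unique _ h (@cvg_mx_cst _ _ _ _ _ (0 : M))).
by apply/eqP; rewrite -addr_eq0 addrC XX.
Qed.

(** The product rule gives [X * A + A * dagger X], and [dagger X = - X] turns this into the
    commutator. *)
Lemma cvg_dq_conj U X A : (forall x, unitary (U x)) -> dq U @ F --> X ->
  (fun x => (((s x)^-1)%:C : C) *: (U x * A * dagger (U x) - A)) @ F -->
  ad X A.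
Proof.
move=> uU UX; have UXd := cvg_dq_dagger UX; have Ud1 := dq_cvg1 UXd.
rewrite (_ : (fun x => _) = (fun x => dq U x * A * dagger (U x) +
    A * dq (fun x => dagger (U x)) x)).
  have -> : ad X A = X * A * 1 + A * dagger X.
    by rewrite (dq_skew uU UX) mulr1 mulrN.
  apply: cvg_mxD; last exact: cvg_mxM (@cvg_mx_cst _ _ _ _ _ A) UXd.
  exact: cvg_mxM (cvg_mxM UX (@cvg_mx_cst _ _ _ _ _ A)) Ud1.
apply/funext => x; rewrite /dq -!scalerAl -scalerAr -scalerDr.
by rewrite !(mulrBl, mulrBr) mul1r mulr1 addrA subrK.
Qed.

(** The exponent may vary with the parameter: [Y] is eventually bounded by [nr X + 1], so
    [expm_bound] makes the error at most a constant times [s]. This generality gives closedness of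
    the Lie algebra. *)
Lemma cvg_dq_expm (Y : T -> M) X : Y @ F --> X ->
  dq (fun x => expm (((s x)%:C : C) *: Y x)) @ F --> X.
Proof.
move=> YX.
pose c := nr X + 1; pose e := expR (n.+1%:R * c) + expR (n.+1%:R * c).
rewrite -[X]add0r.
rewrite (_ : dq _ = (fun x => (dq (fun x => expm (((s x)%:C : C) *: Y x)) x
  - Y x) + Y x)); last by apply/funext => x; rewrite subrK.
apply: (cvg_mxD _ YX); apply/cvg_nrP.
have Yc : \near F, nr (Y F) <= c.
  by apply: (cvgr_le _ (cvg_nr YX)); rewrite /c ltrDl.
have s1 : \near F, s F <= 1.
  exact: (cvgr_le _ s_cvg0).
apply: (@squeeze_cvgr _ _ _ _ (fun=> 0) (fun x => s x * e)).
- apply: filterS2 Yc s1 => x Yx sx; rewrite nr_ge0 subr0 /=.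
  have := @expm_bound _ _ (Y x) c (s x) Yx; rewrite (ltW (s_gt0 x)) sx.
  move=> /(_ isT); rewrite -/e => h.
  have -> : dq (fun x => expm (((s x)%:C : C) *: Y x)) x - Y x =
    (((s x)^-1)%:C : C) *: (expm (((s x)%:C : C) *: Y x) -
       (1 + ((s x)%:C : C) *: Y x)).
    rewrite /dq opprD addrA [RHS]scalerBr scalerA -rmorphM /= mulVf ?gt_eqF//.
    by rewrite scale1r.
  rewrite nrZ gtr0_norm ?invr_gt0// ler_pdivrMl//.
  by rewrite mulrA -expr2.
- exact: cvg_cst.
- by rewrite -[X in _ --> X](mul0r e); apply: cvgM => //; exact: cvg_cst.
Qed.

End DifferenceQuotient.

(** Invariance of the trace form, from cyclicity of the trace. *)
Lemma mxtrace_ad (R : realType) (n : nat) (X Y Z : 'M[Cplx R]_n.+1) :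
  \tr (ad X Y * Z) = \tr (X * ad Y Z).
Proof.
rewrite /ad mulrBl mulrBr !raddfB /= -!mulrA; congr (_ - _).
by rewrite (mulrA X); exact: (mxtrace_mulC Y (X * Z)).
Qed.

(** * The Lie algebra of a compact matrix group *)

Section LieAlgebra.
Variables (R : realType) (n : nat).
Local Notation C := (Cplx R).
Local Notation M := 'M[C]_n.+1.
Implicit Types (A B W X Y Z U V : M).
Variable K : set M.
Hypotheses (Ksub : subgroup_of_U K) (Kcomp : compact K).

Let K_unitary U : K U -> unitary U.
Proof. by case: Ksub => h _ _ _; exact: h. Qed.

Let K1 : K 1. Proof. by case: Ksub. Qed.

Let KM U V : K U -> K V -> K (U * V).
Proof. by case: Ksub => _ _ h _; exact: h. Qed.

Let Kdagger U : K U -> K (dagger U).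
Proof. by case: Ksub => _ _ _ h; exact: h. Qed.

Lemma subgroupX U k : K U -> K (U ^+ k).
Proof.
move=> KU; elim: k => [|k IH]; first by rewrite expr0.
by rewrite exprS; exact: KM.
Qed.

Lemma compact_cvg_mem (T : Type) (F : set_system T) {FF : ProperFilter F}
  (f : T -> M) A : (forall x, K (f x)) -> f @ F --> A -> K A.
Proof.
move=> Kf; apply: (closed_cvg K); last exact: nearW.
by apply: compact_closed => //; exact: norm_hausdorff.
Qed.

(* With [k = floor (t / s)] one has [U ^+ k ~ expm (s X) ^+ k = expm (k s X)],
   because [k] multiples of the error [nr (U - expm (s X)) = o(s)] tend to 0. *)
Lemma tangent_lie (T : Type) (F : set_system T) {FF : ProperFilter F}
    (s : T -> R) (U : T -> M) X :
  (forall x, 0 < s x) -> s @ F --> (0 : R) -> (forall x, K (U x)) ->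
  dq s U @ F --> X -> lie_algebra K X.
Proof.
move=> s_gt0 s0 KU UX.
have uU x : unitary (U x) := K_unitary (KU x).
have sX : skew_hermitian X by exact: (dq_skew s_gt0 s0 uU UX).
(* Negative times follow by taking adjoints, which stay in [K]. *)
suff pos t : 0 <= t -> K (expm ((t%:C : C) *: X)).
  move=> t; have [/pos//|t0] := leP 0 t.
  rewrite -[t]opprK -expm_dagger//; apply: Kdagger; apply: pos.
  by rewrite oppr_ge0 ltW.
move=> t0; pose k x := Num.truncn (t / s x).
pose E x : M := expm (((s x)%:C : C) *: X).
have uE x : unitary (E x) := expm_unitary _ sX.
have kP x : (k x)%:R * s x <= t /\ t - s x <= (k x)%:R * s x.
  have /truncn_itv/andP[h1 h2] : 0 <= t / s x by rewrite divr_ge0// ltW.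
  split; first by rewrite -ler_pdivlMr.
  move: h2; rewrite ltr_pdivrMr// -natr1 mulrDl mul1r => /ltW.
  by rewrite lerBlDr.
have cE : (fun x => E x ^+ k x) @ F --> expm ((t%:C : C) *: X).
  rewrite (_ : (fun x => _) = (fun x => expm ((((k x)%:R * s x)%:C : C) *: X))).
    apply: cvg_expm => //.
    apply: (@squeeze_cvgr _ _ _ _ (fun x => t - s x) (fun=> t)).
    - by apply: nearW => x; have [h1 h2] := kP x; rewrite h1 h2.
    - rewrite -[X in _ --> X]subr0; apply: cvgB => //; exact: cvg_cst.
    - exact: cvg_cst.
  by apply/funext => x; rewrite expm_natM.
have dE : dq s E @ F --> X.
  exact: (cvg_dq_expm s_gt0 s0 (@cvg_mx_cst _ _ _ _ _ X)).
have cD : (fun x => U x ^+ k x - E x ^+ k x) @ F --> (0 : M).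
  apply/cvg_nrP.
  have h : (fun x => t * (n.+1%:R ^+ 2 * nr (dq s U x - dq s E x))) @ F -->
      (0 : R).
    rewrite -(mulr0 t); apply: cvgM; first exact: cvg_cst.
    rewrite -(mulr0 (n.+1%:R ^+ 2)); apply: cvgM; first exact: cvg_cst.
    rewrite -[X in _ --> X](@nr0 R n) -(subrr X); apply: cvg_nr.
    exact: (cvg_mxB UX dE).
  apply: squeeze_cvgr (cvg_cst 0) h; apply: nearW => x; rewrite subr0 nr_ge0/=.
  rewrite (le_trans (nr_exprB _ (uU x) (uE x)))//.
  have -> : U x - E x = ((s x)%:C : C) *: (dq s U x - dq s E x).
    rewrite {1}(dqK s_gt0 U) {1}(dqK s_gt0 E) opprD addrACA subrr add0r.
    by rewrite scalerBr.
  rewrite nrZ gtr0_norm//; set d := nr _.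
  rewrite [leLHS](_ : _ = (k x)%:R * s x * (n.+1%:R ^+ 2 * d)); last by ring.
  rewrite ler_wpM2r//; last by have [] := kP x.
  by rewrite mulr_ge0// ?exprn_ge0// nr_ge0.
apply: (@compact_cvg_mem _ F _ (fun x => U x ^+ k x)).
  by move=> x; exact: subgroupX.
rewrite -[expm _]add0r.
rewrite (_ : (fun x => _) = (fun x => (U x ^+ k x - E x ^+ k x) + E x ^+ k x)).
  exact: (cvg_mxD cD cE).
by apply/funext => x; rewrite subrK.
Qed.

Let harm_gt0 m : 0 < @harmonic R m.
Proof. by rewrite /harmonic /= invr_gt0. Qed.

Let harm_cvg0 : @harmonic R @ \oo --> (0 : R).
Proof. exact: cvg_harmonic. Qed.

Let dq_expm X : dq (@harmonic R)
  (fun m => expm (((harmonic m)%:C : C) *: X)) @ \oo --> X.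
Proof.
exact: (cvg_dq_expm harm_gt0 harm_cvg0 (@cvg_mx_cst _ _ _ _ _ X)).
Qed.

(** [lie_algebra] constrains only exponentials; [X] is recovered as the derivative of a unitary
    curve. *)
Lemma lie_skew X : lie_algebra K X -> skew_hermitian X.
Proof.
move=> KX; apply: (dq_skew harm_gt0 harm_cvg0 _ (@dq_expm X)) => m.
exact: K_unitary.
Qed.

(** With [s = 1 / (m + 1)], the elements [expm (s Y m)] of [K] have tangent [X]. *)
Lemma lie_cvg (Y : nat -> M) X : (forall m, lie_algebra K (Y m)) ->
  Y @ \oo --> X -> lie_algebra K X.
Proof.
move=> KY YX.
apply: (tangent_lie harm_gt0 harm_cvg0 _ (cvg_dq_expm harm_gt0 harm_cvg0 YX)).
by move=> m; exact: KY.
Qed.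

(** The sum is the tangent of [expm (s X) * expm (s Y)]. *)
Lemma lieD X Y : lie_algebra K X -> lie_algebra K Y -> lie_algebra K (X + Y).
Proof.
move=> KX KY.
apply: (tangent_lie harm_gt0 harm_cvg0 _
  (cvg_dqM harm_gt0 harm_cvg0 (@dq_expm X) (@dq_expm Y))).
by move=> m; exact: KM.
Qed.

Lemma lieZ (r : R) X : lie_algebra K X -> lie_algebra K ((r%:C : C) *: X).
Proof. by move=> KX t; rewrite scalerA -rmorphM; exact: KX. Qed.

Lemma lie_conj U X : K U -> lie_algebra K X -> lie_algebra K (U * X * dagger U).
Proof.
move=> KU KX t; rewrite expm_conj//; last exact: K_unitary.
  by apply: KM; [exact: KM|exact: Kdagger].
exact: lie_skew.
Qed.

(** The bracket is a limit of scaled differences between conjugates of [Y] and [Y] itself, and these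
    lie in the closed real subspace. *)
Lemma lie_ad X Y : lie_algebra K X -> lie_algebra K Y -> lie_algebra K (ad X Y).
Proof.
move=> KX KY.
have uE m : unitary (expm (((harmonic m)%:C : C) *: X)) := K_unitary (KX _).
apply: (lie_cvg _ (cvg_dq_conj harm_gt0 harm_cvg0 uE (@dq_expm X))) => m.
apply/lieZ/lieD; first exact: lie_conj.
by rewrite -scaleN1r -(rmorphN1 (real_complex R)); exact: lieZ.
Qed.

Lemma continuous_compact_min (L : set M) (f : M -> R) : compact L -> L !=set0 ->
  continuous f -> exists2 U, L U & forall V, L V -> f U <= f V.
Proof.
move=> cL L0 cf.
have [U] := compact_EVT_min L0 cL (continuous_subspaceT cf).
by rewrite inE => LU h; exists U => // V LV; apply: h; rewrite inE.
Qed.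

Lemma lie_conj_commute W X : lie_algebra K W -> lie_algebra K X ->
  exists2 U, K U & U * W * dagger U * X = X * (U * W * dagger U).
Proof.
move=> KW KX.
have cvg_tr T (F : set_system T) (FF : Filter F) (f : T -> M) A : f @ F --> A ->
    (fun x => complex.Re (\tr (f x))) @ F --> complex.Re (\tr A).
  move=> /cvg_entryP fA; apply: cvg_Re; rewrite /mxtrace.
  by apply: cvg_big => [|i _]; [exact: add_continuous|exact: fA].
pose f U : R := complex.Re (\tr (U * W * dagger U * X)).
have [U0 KU0 minU0] : exists2 U, K U & forall V, K V -> f U <= f V.
  apply: continuous_compact_min => //; first by exists 1.
  move=> U; apply: (@cvg_tr _ (nbhs U) _ (fun V => V * W * dagger V * X)).
  apply: cvg_mxM (@cvg_mx_cst _ _ _ _ _ X).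
  apply: cvg_mxM; last by apply: cvg_dagger; exact: cvg_id.
  by apply: cvg_mxM (@cvg_mx_cst _ _ _ _ _ W); exact: cvg_id.
exists U0 => //; set W0 := U0 * W * dagger U0.
have KW0 : lie_algebra K W0 by exact: lie_conj.
pose Z := ad W0 X; have KZ : lie_algebra K Z := lie_ad KW0 KX.
suff : Z = 0 by move/eqP; rewrite subr_eq0 => /eqP.
pose E m : M := expm (((harmonic m)%:C : C) *: Z).
have KE m : K (E m) by exact: KZ.
have uE m : unitary (E m) by exact: K_unitary.
have cE : (fun m => (((harmonic m)^-1)%:C : C) *:
    (E m * W0 * dagger (E m) - W0)) @ \oo --> ad Z W0.
  exact: (cvg_dq_conj harm_gt0 harm_cvg0 uE (@dq_expm Z)).
(* First-order condition: moving from [U0] to [E m * U0] cannot decrease [f], so the one-sided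
   derivative in the direction [Z] is nonnegative. *)
have ge0 : 0 <= complex.Re (\tr (ad Z W0 * X)).
  have cEX : (fun m => (((harmonic m)^-1)%:C : C) *:
      (E m * W0 * dagger (E m) - W0) * X) @ \oo --> ad Z W0 * X.
    exact: cvg_mxM cE (@cvg_mx_cst _ _ _ _ _ X).
  apply: (cvgr_to_ge (cvg_tr _ _ _ _ _ cEX)).
  apply: nearW => m; rewrite -scalerAl mxtraceZ ReM_real mulr_ge0//.
    by rewrite invr_ge0 ltW.
  have := minU0 _ (KM (KE m) KU0); rewrite /f.
  have -> : E m * U0 * W * dagger (E m * U0) = E m * W0 * dagger (E m).
    by rewrite daggerM /W0 !mulrA.
  rewrite -/W0 mulrBl raddfB /= -subr_ge0.
  by case: (\tr _) (\tr _) => ? ? [].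
(* Invariance turns the trace into that of [Z * Z], and [Z] is skew-Hermitian. *)
have trE : \tr (ad Z W0 * X) = - \sum_i \sum_j `|Z i j| ^+ 2.
  rewrite mxtrace_ad -/Z.
  have -> : Z * Z = - (Z * dagger Z) by rewrite (lie_skew KZ) mulrN opprK.
  rewrite raddfN /=; congr (- _); apply: eq_bigr => i _; rewrite mxE.
  by apply: eq_bigr => j _; rewrite daggerE -normCK.
have sum0 : \sum_i \sum_j `|Z i j| ^+ 2 = 0.
  have p0 : 0 <= \sum_i \sum_j `|Z i j| ^+ 2.
    by apply: sumr_ge0 => i _; apply: sumr_ge0 => j _; rewrite exprn_ge0.
  apply/eqP; rewrite eq_le p0 andbT.
  move: ge0 p0; rewrite trE; case: (\sum_i _) => a b /=; rewrite !lecE /=.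
  by rewrite oppr_ge0 => -> /andP[/eqP -> _]; rewrite eqxx.
apply/matrixP => i j; rewrite [RHS]mxE; apply/eqP; rewrite -normr_eq0.
rewrite -sqrf_eq0; apply/eqP.
have ge i' : 0 <= \sum_j `|Z i' j| ^+ 2.
  by apply: sumr_ge0 => ? _; rewrite exprn_ge0.
have /psumr_eq0P/(_ sum0 i isT) : forall i', true -> 0 <= \sum_j `|Z i' j| ^+ 2.
  by move=> ? _; exact: ge.
move=> h; have : forall j', true -> 0 <= `|Z i j'| ^+ 2.
  by move=> ? _; rewrite exprn_ge0.
by move/psumr_eq0P => /(_ h j isT).
Qed.

End LieAlgebra.

(** * Centralizers, conjugation into the torus algebra, and the converse *)

Section Centralizer.
Variables (R : realType) (n : nat).
Local Notation C := (Cplx R).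
Local Notation M := 'M[C]_n.+1.
Implicit Types (A B W X Y Z U V : M) (K : set M).

Definition centralizer K A : set M := K `&` [set U | U * A = A * U].

Lemma closed_commuting A : closed [set U : M | U * A = A * U].
Proof.
have -> : [set U : M | U * A = A * U] =
    (fun U => U * A - A * U) @^-1` [set 0].
  apply/seteqP; split=> U /=; first by move=> ->; rewrite subrr.
  by move/eqP; rewrite subr_eq0 => /eqP.
apply: preimage_closed.
  move=> U _; apply: (@cvg_mxB _ _ _ (nbhs U)).
    by apply: cvg_mxM; [exact: cvg_id|exact: cvg_mx_cst].
  by apply: cvg_mxM; [exact: cvg_mx_cst|exact: cvg_id].
apply: accessible_closed_set1; apply: hausdorff_accessible.
exact: norm_hausdorff.
Qed.

Lemma compact_centralizer K A : compact K -> compact (centralizer K A).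
Proof. by move=> cK; apply: compact_closedI cK _; exact: closed_commuting. Qed.

Lemma unitary_comm_dagger U A : unitary U -> U * A = A * U ->
  dagger U * A = A * dagger U.
Proof.
move=> uU UA; rewrite -[A in LHS]mulr1 -uU (mulrA A) -UA !mulrA.
by rewrite (unitaryV uU) mul1r.
Qed.

Lemma subgroup_centralizer K A :
  subgroup_of_U K -> subgroup_of_U (centralizer K A).
Proof.
move=> [uK K1 KM Kd]; split.
- by move=> U [/uK].
- by split=> //; rewrite /= mul1r mulr1.
- move=> U V [KU UA] [KV VA]; split; first exact: KM.
  by rewrite /= -mulrA VA !mulrA UA.
- move=> U [KU UA]; split; first exact: Kd.
  by apply: unitary_comm_dagger => //; exact: uK.
Qed.

(** This lets the conjugation argument start again inside the centralizer. *)
Lemma lie_centralizer K A X : subgroup_of_U K -> lie_algebra K X ->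
  X * A = A * X -> lie_algebra (centralizer K A) X.
Proof.
move=> sK KX XA t; split; first exact: KX.
by apply: expm_comm XA; exact: lie_skew KX.
Qed.

Lemma unitary_conjK U A B : unitary U ->
  U * A * dagger U = B <-> U * A = B * U.
Proof.
move=> uU; split=> [<-|UA]; first by rewrite -!mulrA (unitaryV uU) mulr1.
by rewrite UA -mulrA uU mulr1.
Qed.

(* Conjugating successively inside the centralizers of the earlier elements
   replaces the choice of a regular element of the torus algebra. *)
Lemma lie_conj_commute_seq (xs : seq M) K W :
  subgroup_of_U K -> compact K -> lie_algebra K W ->
  (forall X, X \in xs -> lie_algebra K X) ->
  (forall X Y, X \in xs -> Y \in xs -> X * Y = Y * X) ->
  exists2 U, K U & forall X, X \in xs ->
    U * W * dagger U * X = X * (U * W * dagger U).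
Proof.
elim: xs K W => [|X xs IH] K W sK cK KW Kxs xsC.
  by exists 1 => //; case: sK.
have KX : lie_algebra K X by apply: Kxs; rewrite mem_head.
have [U1 KU1 U1X] := lie_conj_commute sK cK KW KX.
(* The induction runs over all groups [K]: here it is used for the centralizer of [X], whose Lie
   algebra contains the conjugate of [W] just found and the remaining elements. *)
have [U2 [KU2 U2X] U2xs] : exists2 U, centralizer K X U & forall Y, Y \in xs ->
    U * (U1 * W * dagger U1) * dagger U * Y =
    Y * (U * (U1 * W * dagger U1) * dagger U).
  apply: IH.
  - exact: subgroup_centralizer.
  - exact: compact_centralizer.
  - exact: (lie_centralizer sK (lie_conj sK KU1 KW) U1X).
  - move=> Y Yxs; apply: (lie_centralizer sK).
      by apply: Kxs; rewrite in_cons Yxs orbT.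
    by apply: xsC; rewrite ?mem_head// in_cons Yxs orbT.
  - by move=> Y Z Yxs Zxs; apply: xsC; rewrite in_cons ?Yxs ?Zxs orbT.
have uU2 : unitary U2 by case: sK => uK _ _ _; exact: uK.
exists (U2 * U1); first by case: sK => _ _ KM _; exact: KM.
have -> : U2 * U1 * W * dagger (U2 * U1) =
    U2 * (U1 * W * dagger U1) * dagger U2 by rewrite daggerM !mulrA.
move=> Y; rewrite in_cons => /orP[/eqP->|/U2xs//].
(* Conjugation by [U2] preserves commutation with [X], because [U2] itself commutes with [X]. *)
move: U1X; move: (U1 * W * dagger U1) => V VX.
rewrite -mulrA (unitary_comm_dagger uU2 U2X) mulrA -(mulrA _ V) VX.
by rewrite !mulrA U2X.
Qed.

(** A finite list from [t] whose span has maximal dimension spans all of [t], and commuting with [Z]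
    is a linear condition. *)
Lemma commutant_finite (t : set M) : exists2 xs : seq M,
  (forall X, X \in xs -> t X) &
  forall Z, (forall X, X \in xs -> Z * X = X * Z) ->
    forall X, t X -> Z * X = X * Z.
Proof.
pose P d := `[< exists2 xs : seq M, (forall X, X \in xs -> t X) &
  \dim <<xs>>%VS = d >].
have P0 : exists d, P d.
  by exists 0%N; apply/asboolP; exists [::] => //; rewrite span_nil dimv0.
have Pub d : P d -> (d <= \dim {: M})%N.
  by move=> /asboolP[xs _ <-]; apply: dimvS; exact: subvf.
case: (ex_maxnP P0 Pub) => d /asboolP[xs txs dxs] dmax.
exists xs => // Z Zxs X tX.
have Xxs : X \in <<xs>>%VS.
  have sub : (<<xs>> <= <<X :: xs>>)%VS by rewrite span_cons addvSr.
  have dle : (\dim <<X :: xs>> <= \dim <<xs>>)%N.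
    rewrite dxs; apply: dmax; apply/asboolP; exists (X :: xs) => // Y.
    by rewrite in_cons => /orP[/eqP->|/txs].
  have /eqP -> : <<xs>>%VS == <<X :: xs>>%VS by rewrite eqEdim sub dle.
  by apply: memv_span; rewrite mem_head.
have -> : X = \sum_i coord (in_tuple xs) i X *: xs`_i :=
  @coord_span _ _ _ (in_tuple xs) X Xxs.
rewrite mulr_sumr mulr_suml; apply: eq_bigr => i _.
by rewrite -scalerAr -scalerAl Zxs// mem_nth.
Qed.

(** Adjoining the real multiples of [W] to [t] gives an Abelian subalgebra, which equals [t] by
    maximality. *)
Lemma torus_centralizer K (t : set M) W : subgroup_of_U K -> compact K ->
  torus_algebra (lie_algebra K) t -> lie_algebra K W ->
  (forall X, t X -> W * X = X * W) -> t W.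
Proof.
move=> sK cK [[tK t0 tD tZ tad] tab tmax] KW Wt.
pose s : set M := [set Z | exists Y (r : R), t Y /\ Z = Y + (r%:C : C) *: W].
have tW Y Y' (r r' : R) : t Y -> t Y' ->
    ad (Y + (r%:C : C) *: W) (Y' + (r'%:C : C) *: W) = 0.
  move=> tY tY'; have := tab _ _ tY tY'; rewrite /ad => /eqP.
  rewrite !subr_eq0 => /eqP YY'; apply/eqP; rewrite subr_eq0; apply/eqP.
  rewrite !mulrDl !mulrDr -!scalerAl -!scalerAr YY' (Wt _ tY) (Wt _ tY').
  have -> : (r%:C : C) *: ((r'%:C : C) *: (W * W)) =
      (r'%:C : C) *: ((r%:C : C) *: (W * W)).
    by rewrite !scalerA (mulrC (r%:C : C)).
  exact: addrACA.
have sK' : real_subalgebra (lie_algebra K) s.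
  split.
  - move=> _ [Y [r [tY ->]]]; apply: (lieD sK cK); first exact: tK.
    exact: lieZ.
  - by exists 0, 0; split; [exact: t0|rewrite scale0r addr0].
  - move=> _ _ [Y [r [tY ->]]] [Y' [r' [tY' ->]]].
    exists (Y + Y'), (r + r'); split; first exact: tD.
    by rewrite rmorphD scalerDl addrACA.
  - move=> a _ [Y [r [tY ->]]].
    exists ((a%:C : C) *: Y), (a * r); split; first exact: tZ.
    by rewrite rmorphM scalerDr scalerA.
  - move=> _ _ [Y [r [tY ->]]] [Y' [r' [tY' ->]]].
    exists 0, 0; split; first exact: t0.
    by rewrite (tW _ _ _ _ tY tY') scale0r addr0.
have st : s `<=` t.
  rewrite (tmax s sK')//.
    by move=> _ _ [Y [r [tY ->]]] [Y' [r' [tY' ->]]]; exact: tW.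
  by move=> Y tY; exists Y, 0; split; [exact: tY|rewrite scale0r addr0].
by apply: st; exists 0, 1; split; [exact: t0|rewrite scale1r add0r].
Qed.

Lemma torus_conj K (t : set M) W : subgroup_of_U K -> compact K ->
  torus_algebra (lie_algebra K) t -> lie_algebra K W ->
  exists2 U, K U & t (U * W * dagger U).
Proof.
move=> sK cK tt KW; have [[tK _ _ _ _] tab _] := tt.
have [xs xst xsC] := commutant_finite t.
have [U KU Uxs] : exists2 U, K U & forall X, X \in xs ->
    U * W * dagger U * X = X * (U * W * dagger U).
  apply: (lie_conj_commute_seq sK cK KW) => [X /xst/tK//|X Y /xst tX /xst tY].
  by have /eqP := tab _ _ tX tY; rewrite subr_eq0 => /eqP.
exists U => //; apply: (torus_centralizer sK cK tt); last exact: xsC.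
exact: (lie_conj sK KU KW).
Qed.

Lemma ad_conj U X A : unitary U ->
  ad (U * X * dagger U) (U * A * dagger U) = U * ad X A * dagger U.
Proof.
move=> uU; rewrite /ad mulrBr mulrBl !mulrA.
by rewrite -!(mulrA _ (dagger U) U) (unitaryV uU) !mulr1.
Qed.

Lemma ad_eigvec_conj U X A : unitary U -> ad_eigvec_nonzero X A ->
  ad_eigvec_nonzero (U * X * dagger U) (U * A * dagger U).
Proof.
move=> uU [A0 [lam lam0 XA]]; split.
  apply: contraNneq A0 => /(congr1 (fun Z => dagger U * Z * U)).
  rewrite !mulrA (unitaryV uU) mul1r -mulrA (unitaryV uU) mulr1 => ->.
  by rewrite mulr0 mul0r.
by exists lam => //; rewrite ad_conj// XA -scalerAr -scalerAl.
Qed.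

Lemma ad_eigvec_weakly_rot_sym K A Om : subgroup_of_U K ->
  lie_algebra K Om -> ad_eigvec_nonzero Om A -> weakly_rot_sym K A.
Proof.
move=> sK KOm [A0 [lam lam0 OmA]].
have [mu mu0 rot] := ad_eigenvector_rotation (lie_skew sK KOm) A0 lam0 OmA.
case: (sK) => uK K1 KM Kd.
have rotK phi : exists2 V, K V & V * A * dagger V = expi phi *: A.
  (* At time [t] the phase is [t * mu], so the angle [phi] is reached at [phi / mu]. *)
  exists (expm (((phi / mu)%:C : C) *: Om)); first exact: KOm.
  apply/unitary_conjK; first exact/uK/KOm.
  by rewrite rot divfK// -scalerAl.
have sub phi B : Defs.orbit K A B -> Defs.orbit K A (expi phi *: B).
  move=> [U KU ->]; have [V KV VA] := rotK phi.
  exists (U * V); first exact: KM.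
  have -> : U * V * A * dagger (U * V) = U * (V * A * dagger V) * dagger U.
    by rewrite daggerM !mulrA.
  by rewrite VA -scalerAr -scalerAl.
move=> phi; apply/seteqP; split=> [_ [B oB <-]|B oB]; first exact: sub.
exists (expi (- phi) *: B); first exact: sub.
by rewrite scalerA -expiD subrr expi0 scale1r.
Qed.

End Centralizer.

(** * Ultrafilter limits and the generator of the rotation *)

Lemma ultra_compact_cvg (T : Type) (G : set_system T) (S : topologicalType)
    (A : set S) (u : T -> S) :
  UltraFilter G -> compact A -> (forall x, A (u x)) ->
  exists2 l, A l & u @ G --> l.
Proof.
move=> GU cA Au; have PG : ProperFilter G by exact: ultra_proper.
have [l [Al cl]] : A `&` cluster (u @ G) !=set0.
  apply: cA; apply: (@filterS _ G _ setT); last exact: filterT.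
  by move=> x _; exact: Au.
(* An ultrafilter contains the preimage of [N] or its complement; the latter would contradict that
   [l] is a cluster point. *)
exists l => // N Nl; have [//|GN] := in_ultra_setVsetC (u @^-1` N) GU.
have [y [uNy Ny]] : ~` N `&` N !=set0 by apply: cl Nl; exact: GN.
by case: uNy.
Qed.

Section RotationalSymmetry.
Variables (R : realType) (n : nat).
Local Notation C := (Cplx R).
Local Notation M := 'M[C]_n.+1.
Implicit Types (A B W X Y Z U V : M) (K : set M).

(** This replaces extraction of convergent subsequences: real and imaginary parts of the entries
    stay in a compact interval. *)
Lemma ultra_bounded_cvg (T : Type) (G : set_system T) (f : T -> M) (c : R) :
  UltraFilter G -> (forall x, nr (f x) <= c) -> exists X, f @ G --> X.
Proof.
move=> GU fc; have PG : ProperFilter G by exact: ultra_proper.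
have bounded (u : T -> R) :
    (forall x, `|u x| <= c) -> exists l : R, u @ G --> l.
  move=> uc; have [|l _ ul] :=
    @ultra_compact_cvg T G R [set` `[- c, c]] u GU (@segment_compact _ _ _).
    by move=> x; rewrite /= in_itv /= -ler_norml.
  by exists l.
have fij i j x : `|f x i j| <= c%:C.
  by rewrite (le_trans (norm_entry_le _ i j))// lecR.
have /choice[L HL] : forall ij : 'I_n.+1 * 'I_n.+1, exists l : C,
    (fun x => f x ij.1 ij.2) @ G --> l.
  move=> [i j].
  have [a ca] := bounded _ (fun x => normRe_le (fij i j x)).
  have [b cb] := bounded _ (fun x => normIm_le (fij i j x)).
  by exists (Complex a b); exact: cvg_complex.
exists (\matrix_(i, j) L (i, j)); apply/cvg_entryP => i j; rewrite mxE.
exact: HL.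
Qed.

(** The sine is positive there, since [1 < 2 <= pi]. The range contains every harmonic angle. *)
Lemma expi_neq1 (x : R) : 0 < x <= 1 -> expi x != 1.
Proof.
move=> /andP[x0 x1]; have : 0 < sin x.
  apply: sin_gt0_pi; rewrite x0 (le_lt_trans x1)//.
  by have := pi_ge2 R; lra.
apply: contraTneq; rewrite /expi imaginaryE => /(congr1 (@complex.Im R)) /=.
by rewrite mul0r mul1r !add0r => ->; rewrite ltxx.
Qed.

Lemma cvg_scale (T : Type) (F : set_system T) {FF : Filter F} (c : T -> C)
  (a : C) A : c @ F --> a -> (fun x => c x *: A) @ F --> a *: A.
Proof.
move=> ca; apply/cvg_entryP => i j; rewrite mxE.
under eq_fun do rewrite mxE.
by apply: cvgM ca _; exact: cvg_cst.
Qed.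

Lemma weakly_rot_sym_ad_eigvec K A : subgroup_of_U K -> compact K -> A != 0 ->
  weakly_rot_sym K A ->
  exists2 Om, lie_algebra K Om & ad_eigvec_nonzero Om A.
Proof.
move=> sK cK A0 wrs; case: (sK) => uK K1 KM Kd.
pose ha : nat -> R := @harmonic R.
have ha_itv m : 0 < ha m <= 1.
  by rewrite /ha /harmonic /= invr_gt0 ltr0n /= invf_le1// ler1n.
have /choice[g Hg] : forall m, exists U, K U /\
    U * A * dagger U = expi (ha m) *: A.
  move=> m; have : Defs.orbit K A (expi (ha m) *: A).
    rewrite -(wrs (ha m)); exists A => //.
    by exists 1 => //; rewrite dagger1 mulr1 mul1r.
  by move=> [U KU ->]; exists U.
pose L := centralizer K A.
have [uL L1 LM Ld] : subgroup_of_U L by exact: subgroup_centralizer.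
have cL : compact L by exact: compact_centralizer.
have /choice[h Hh] : forall m, exists U, L U /\
    forall V, L V -> nr (g m * U - 1) <= nr (g m * V - 1).
  move=> m.
  have [|U LU minU] := @continuous_compact_min R n L
      (fun U => nr (g m * U - 1)) cL (ex_intro _ 1 L1).
    move=> U; apply: (@cvg_nr _ _ _ (nbhs U)).
    apply: cvg_mxB; last exact: cvg_mx_cst.
    by apply: cvg_mxM; [exact: cvg_mx_cst|exact: cvg_id].
  by exists U.
pose u m := g m * h m.
have Ku m : K (u m).
  by apply: KM; [have [] := Hg m|have [[]] := Hh m].
have uu m : unitary (u m) by exact: uK.
have uA m : u m * A * dagger (u m) = expi (ha m) *: A.
  have [Kg <-] := Hg m; have [[Kh hA] _] := Hh m.
  rewrite /u daggerM -(mulrA (g m)) hA !mulrA -(mulrA _ (h m)).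
  by rewrite (uK _ Kh) mulr1.
have u_min m V : L V -> nr (u m - 1) <= nr (u m * V - 1).
  move=> LV; have [Lh hmin] := Hh m; rewrite /u -mulrA.
  by apply: hmin; exact: LM.
pose s m := nr (u m - 1).
(* If [u m] were 1, it would not rotate [A] by the nontrivial angle [ha m]. *)
have s_gt0 m : 0 < s m.
  rewrite lt_def nr_ge0 andbT; apply/eqP => /nr_eq0/eqP; rewrite subr_eq0.
  move=> /eqP u1; have := uA m; rewrite u1 dagger1 mulr1 mul1r => /eqP.
  rewrite -subr_eq0 -{1}[A]scale1r -scalerBl scaler_eq0 (negbTE A0) orbF.
  by rewrite subr_eq0 eq_sym (negbTE (expi_neq1 (ha_itv m))).
have [G [GU ooG]] := ultraFilterLemma (_ : ProperFilter \oo).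
have PG : ProperFilter G by exact: ultra_proper.
have ha0 : ha @ G --> (0 : R).
  by move=> N /(@cvg_harmonic R); exact: ooG.
(* The limit [v] need not be 1 a priori, but it stabilizes [A] since the angles tend to 0. Hence
   [dagger v] is an admissible competitor, and minimality gives [s m <= nr (u m * dagger v - 1)],
   which tends to 0. *)
have [v Kv uv] := ultra_compact_cvg GU cK Ku.
have vA : v * A * dagger v = A.
  have c1 : (fun m => u m * A * dagger (u m)) @ G --> v * A * dagger v.
    apply: cvg_mxM (cvg_dagger uv).
    exact: (cvg_mxM uv (@cvg_mx_cst _ _ _ _ _ A)).
  have c2 : (fun m => u m * A * dagger (u m)) @ G --> A.
    rewrite (funext uA) -[X in _ --> X]scale1r -(expi0 R).
    by apply: cvg_scale; exact: cvg_expi.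
  exact: (cvg_mx_unique _ c1 c2).
have Ldv : L (dagger v).
  by apply: Ld; split => //; apply/(unitary_conjK _ _ (uK _ Kv)).
have s0 : s @ G --> (0 : R).
  have c1 : (fun m => nr (u m * dagger v - 1)) @ G --> (0 : R).
    have <- : nr (v * dagger v - 1) = 0 by rewrite (uK _ Kv) subrr nr0.
    apply: cvg_nr; apply: cvg_mxB; last exact: cvg_mx_cst.
    exact: (cvg_mxM uv (@cvg_mx_cst _ _ _ _ _ _)).
  apply: squeeze_cvgr (cvg_cst 0) c1; apply: nearW => m.
  by rewrite nr_ge0 u_min.
(* By the choice of [s], these quotients have norm exactly 1. *)
have [X uX] : exists X, dq s u @ G --> X.
  apply: (@ultra_bounded_cvg _ _ _ 1 GU) => m.
  by rewrite /dq nrZ gtr0_norm ?invr_gt0// mulVf ?gt_eqF.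
have KX : lie_algebra K X by exact: (tangent_lie sK cK s_gt0 s0 Ku uX).
have [i [j Aij]] : exists i j, A i j != 0.
  apply/not_existsP => A00; move/negP: A0; apply; apply/eqP/matrixP => i j.
  by rewrite [RHS]mxE; apply/eqP/negPn/negP => Aij; apply: (A00 i); exists j.
pose c m : C := (((s m)^-1)%:C : C) * (expi (ha m) - 1).
have cA : (fun m => c m *: A) @ G --> ad X A.
  have cE m : c m *: A =
      (((s m)^-1)%:C : C) *: (u m * A * dagger (u m) - A).
    by rewrite uA /c -scalerA scalerBl scale1r.
  by rewrite (funext cE); exact: (cvg_dq_conj s_gt0 s0 uu uX).
pose mu : C := ad X A i j / A i j.
(* Convergence of the scalars is read off at a nonzero entry of [A]. *)
have cmu : c @ G --> mu.
  have /cvg_entryP/(_ i j) cAij := cA.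
  have -> : c = (fun m => (c m *: A) i j * (A i j)^-1).
    by apply/funext => m; rewrite mxE mulfK.
  by apply: cvgM cAij _; exact: cvg_cst.
have XA : ad X A = mu *: A.
  exact: (cvg_mx_unique _ cA (cvg_scale cmu)).
exists X => //; split=> //; exists mu => //; apply/eqP => mu0.
have XAC : X * A = A * X.
  by apply/eqP; rewrite -subr_eq0 -/(ad X A) XA mu0 scale0r.
have LE m : L (expm (((s m)%:C : C) *: - X)).
  have := lie_centralizer sK KX XAC (- s m).
  by rewrite rmorphN scaleNr scalerN.
have dE : dq s (fun m => expm (((s m)%:C : C) *: - X)) @ G --> - X.
  exact: (cvg_dq_expm s_gt0 s0 (@cvg_mx_cst _ _ _ _ _ (- X))).
have duE : dq s (fun m => u m * expm (((s m)%:C : C) *: - X)) @ G --> X + - X.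
  exact: (cvg_dqM s_gt0 s0 uX dE).
(* By minimality the corrected elements are at distance at least [s m] from 1, so their quotients
   have norm at least 1 and cannot tend to 0. *)
have : (1 : R) <= nr (X + - X).
  apply: (cvgr_to_ge (cvg_nr duE)); apply: nearW => m.
  rewrite /dq nrZ gtr0_norm ?invr_gt0// ler_pdivlMl// mulr1.
  exact: u_min.
by rewrite subrr nr0 ler10.
Qed.

End RotationalSymmetry.

Theorem theorem2p15 (R : realType) (n : nat) (K : set 'M[Cplx R]_n.+1)
  (t : set 'M[Cplx R]_n.+1) (A : 'M[Cplx R]_n.+1) :
  subgroup_of_U K -> compact K -> connected K ->
  torus_algebra (lie_algebra K) t ->
  A != 0 ->
  (weakly_rot_sym K A <->
     exists2 Om, lie_algebra K Om & ad_eigvec_nonzero Om A) /\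
  (weakly_rot_sym K A <->
     exists U, exists Dl,
       [/\ K U, t Dl & ad_eigvec_nonzero Dl (U * A * dagger U)]).
Proof.
move=> sK cK _ tt A0; case: (sK) => uK _ _ Kd; have [[tK _ _ _ _] _ _] := tt.
have wa : weakly_rot_sym K A <->
    exists2 Om, lie_algebra K Om & ad_eigvec_nonzero Om A.
  split; first exact: weakly_rot_sym_ad_eigvec.
  by move=> [Om KOm OmA]; exact: ad_eigvec_weakly_rot_sym KOm OmA.
split=> //; rewrite wa; split=> [[Om KOm OmA]|[U [Dl [KU tDl DlA]]]].
  have [U KU tU] := torus_conj sK cK tt KOm.
  exists U, (U * Om * dagger U); split=> //.
  by apply: ad_eigvec_conj OmA; exact: uK.
(* From (b) to (a): conjugate back by [dagger U], an element of [K]. *)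
exists (dagger U * Dl * dagger (dagger U)).
  exact: (lie_conj sK (Kd _ KU) (tK _ tDl)).
have := ad_eigvec_conj (unitary_dagger (uK _ KU)) DlA.
rewrite daggerK !mulrA (unitaryV (uK _ KU)) mul1r -(mulrA A).
by rewrite (unitaryV (uK _ KU)) mulr1.
Qed.
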